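(* Let $K$ be a field and let $\mathcal{A}$ be a central essential arrangement of hyperplanes in $V=K^3$. Let $P$ denote the set of one-dimensional intersections of hyperplanes of $\mathcal{A}$. Then $\mathcal{A}$ is combinatorially simplicial if and only if \[ 3(|P|-1)=\sum_{v\in P}|\{H\in\mathcal{A}\mid v\subset H\}|. \]
   Context: An arrangement of hyperplanes is a finite set of hyperplanes in $V=K^r$; it is central if all hyperplanes are linear subspaces, and a central arrangement is essential if the intersection of all its hyperplanes is $0$. The intersection lattice $L(\mathcal{A})$ is the set of all intersections of elements of $\mathcal{A}$ (including $V$ as the empty intersection), ordered by reverse inclusion. The characteristic polynomial is $\chi_{\mathcal{A}}(t)=\sum_{X\in L(\mathcal{A})}\mu(X)t^{\dim X}$, where $\mu(X)=\mu(V,X)$ is the Möbius function of $L(\mathcal{A})$. For $X\in L(\mathcal{A})$ the restriction is $\mathcal{A}^X=\{X\cap H\mid H\in\mathcal{A},\ X\not\subseteq H,\ X\cap H\neq\emptyset\}$, an arrangement in $X$. A finite set $\mathcal{A}$ of hyperplanes in $K^r$ is (combinatorially) simplicial if it is a central, essential arrangement satisfying $r\chi_{\mathcal{A}}(-1)+2\sum_{H\in\mathcal{A}}\chi_{\mathcal{A}^H}(-1)=0$. *)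

(* Defs.v *)
From HB Require Import structures.
From mathcomp Require Import all_boot all_order all_algebra finmap.

Set Implicit Arguments.
Unset Strict Implicit.
Unset Printing Implicit Defensive.

Import GRing.Theory.

Local Open Scope fset_scope.
Local Open Scope ring_scope.

Section Mobius.

Variables (T : choiceType) (le : rel T) (L : {fset T}).

(* [n] bounds the recursion depth. A chain of [L] has at most [#|` L|]
   elements, so the bound used in [mobius] is never reached: see [mobiusE]. *)
Fixpoint mobius_rec (n : nat) (x y : T) : int :=
  if n is m.+1 then
    if x == y then 1
    else - \sum_(z <- L | [&& le x z, le z y & z != y]) mobius_rec m x z
  else 0.

Definition mobius (x y : T) : int := mobius_rec #|` L| x y.

Hypotheses (le_refl : reflexive le) (le_anti : antisymmetric le).
Hypothesis (le_trans : transitive le).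

Let below y := count (le^~ y) L.

Let below_gt0 y : y \in L -> (0 < below y)%N.
Proof. by move=> yL; rewrite -has_count; apply/hasP; exists y => /=. Qed.

Let below_lt z y : y \in L -> le z y -> z != y -> (below z < below y)%N.
Proof.
move=> yL zy z_neq_y.
suff: (below z + 1 <= below y)%N by rewrite addn1.
apply: (@leq_trans (count (le^~ z) L + count (pred1 y) L)).
  by rewrite leq_add2l -has_count has_pred1.
rewrite -count_predUI [X in (_ + X)%N](_ : _ = 0%N) ?addn0.
  by apply: sub_count => t /= /orP[tz|/eqP->//]; apply: le_trans tz zy.
rewrite (@eq_count _ _ pred0) ?count_pred0 // => t /=.
apply/negP => /andP[tz /eqP t_y]; move: z_neq_y; rewrite t_y in tz.
by rewrite (le_anti (introT andP (conj zy tz))) eqxx.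
Qed.

Let mobius_rec_stable k m p x y : y \in L -> (below y <= k)%N ->
  (below y <= m)%N -> (below y <= p)%N -> mobius_rec m x y = mobius_rec p x y.
Proof.
elim: k m p y => [|k IHk] m p y yL le_k; first by move: (leq_trans (below_gt0 yL) le_k).
case: m => [|m] le_m; first by move: (leq_trans (below_gt0 yL) le_m).
case: p => [|p] le_p; first by move: (leq_trans (below_gt0 yL) le_p).
rewrite /=; case: eqP => // _; congr (- _).
rewrite big_seq_cond [RHS]big_seq_cond.
apply: eq_bigr => z /and4P[zL _ zy z_neq_y]; have lt_zy := below_lt yL zy z_neq_y.
by apply: IHk => //; rewrite -ltnS; apply: leq_trans lt_zy _.
Qed.

Lemma mobiusE x y : y \in L ->
  mobius x y = if x == y then 1
    else - \sum_(z <- L | [&& le x z, le z y & z != y]) mobius x z.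
Proof.
move=> yL; have le_L z : (below z <= #|` L|)%N by apply: count_size.
rewrite /mobius (@mobius_rec_stable #|` L| _ #|` L|.+1) ?leqW //=.
Qed.

End Mobius.

Section CentralArrangements.

Variables (K : fieldType) (V : vectType K).

(* A central arrangement consists of linear hyperplanes only, so its members,
   and all the intersections of its members, are vector subspaces. They live in
   an ambient subspace [W] of [V], so that a restriction of an arrangement is
   again an arrangement. *)
Definition is_hyperplane (W H : {vspace V}) : bool :=
  (H <= W)%VS && (\dim W == (\dim H).+1).

Definition central_arrangement (W : {vspace V}) (A : {fset {vspace V}}) : Prop :=
  forall H, H \in A -> is_hyperplane W H.

Definition essential (W : {vspace V}) (A : {fset {vspace V}}) : Prop :=
  (W :&: \bigcap_(H <- A) H = 0)%VS.

Definition intersection_lattice (W : {vspace V}) (A : {fset {vspace V}}) :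
    {fset {vspace V}} :=
  [fset (W :&: \bigcap_(H <- B) H)%VS | B : {fset {vspace V}} in fpowerset A].

Definition reverse_inclusion : rel {vspace V} := fun X Y => (Y <= X)%VS.

Definition characteristic_poly (W : {vspace V}) (A : {fset {vspace V}}) : {poly int} :=
  let L := intersection_lattice W A in
  \sum_(X <- L) (mobius reverse_inclusion L W X)%:P * 'X^(\dim X).

(* The condition that [X :&: H] be nonempty is void for linear subspaces. *)
Definition restriction (A : {fset {vspace V}}) (X : {vspace V}) :
    {fset {vspace V}} :=
  [fset (X :&: H)%VS | H in A & ~~ (X <= H)%VS].

Lemma restriction_central (W : {vspace V}) (A : {fset {vspace V}})
    (X : {vspace V}) :
  central_arrangement W A -> (X <= W)%VS ->
  central_arrangement X (restriction A X).
Proof.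
move=> cA sXW _ /imfsetP[H /= /andP[HA nXH] ->].
have /andP[sHW /eqP dW] := cA _ HA.
rewrite /is_hyperplane capvSl -(eqn_add2l (\dim H)) addnC -dimv_sum_cap.
rewrite addnS -addSn eqn_add2r -dW eqn_leq dimvS ?subv_add ?sXW //= dW.
rewrite ltn_neqAle dimvS ?addvSr // andbT; apply: contra nXH => /eqP dH.
have /eqP -> : H == (X + H)%VS by rewrite eqEdim addvSr dH leqnn.
exact: addvSl.
Qed.

End CentralArrangements.

Definition combinatorially_simplicial (K : fieldType) (r : nat)
    (A : {fset {vspace 'rV[K]_r}}) : Prop :=
  [/\ central_arrangement fullv A,
      essential fullv A
    & r%:Z * (characteristic_poly fullv A).[-1]
      + 2 * \sum_(H <- A) (characteristic_poly H (restriction A H)).[-1] = 0].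

(* Main.v *)
Require Import Defs.
From mathcomp Require Import all_boot all_order all_algebra finmap.
From mathcomp Require Import ring lra.

Set Implicit Arguments.
Unset Strict Implicit.
Unset Printing Implicit Defensive.

Import GRing.Theory.

Local Open Scope fset_scope.
Local Open Scope ring_scope.

(** Write [m_v] for the number of members of [A] through a line [v], and [S] for
    the sum of the [m_v] over [v] in [P]. Two facts turn the simpliciality
    equation into the equation on [S].

    The values of the Möbius function over the whole lattice add up to 0: this
    is the recursion at the bottom subspace 0 ([sum_mu]). Subtracting this sum
    from the characteristic polynomial at -1 cancels the even-dimensional terms
    and doubles the others, so that [chi (-1)] is -2 times the sum of [mu X] over
    the [X] of odd dimension ([char_poly_m1]). In particular [mu 0] is never
    computed.

    Hence only codimensions 0, 1 and 2 matter, where [mu] is 1, -1 and [m_X - 1].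
    In dimension 3 the odd-dimensional elements are the whole space and the lines
    of [P], so [chi (-1) = -2 * (1 + S - #|P|)]. In dimension 2 they are the
    members of the arrangement, so [chi (-1)] is twice their number. The
    restriction of [A] to [H] consists of the lines of [P] inside [H]
    ([restriction_lines]), and counting the incident pairs [v <= H] in two ways
    gives [2 * S] for the sum over all restrictions
    ([sum_char_poly_restriction]). The simpliciality equation thus reads
    [- 6 * (1 + S - #|P|) + 4 * S = 0], that is [S = 3 * (#|P| - 1)]. *)

Lemma card_fset_sumZ (T : choiceType) (B : {fset T}) :
  #|` B|%:Z = \sum_(x <- B) 1.
Proof. by rewrite -[LHS]natz card_fset_sum1 natr_sum. Qed.

Lemma card_fset_condZ (T : choiceType) (B : {fset T}) (p : pred T) :
  #|` [fset x in B | p x]|%:Z = \sum_(x <- B) (p x)%:R.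
Proof.
rewrite card_fset_sumZ big_fset /= big_mkcond.
by apply: eq_bigr => x _; case: (p x).
Qed.

(** * The intersection lattice *)

Section Lattice.

Variables (K : fieldType) (V : vectType K).
Implicit Types (U W X H : {vspace V}) (A B : {fset {vspace V}}).

Lemma subv_bigcap_seqP U (s : seq {vspace V}) :
  reflect {in s, forall H, (U <= H)%VS} (U <= \bigcap_(H <- s) H)%VS.
Proof.
elim: s => [|H s IHs]; first by rewrite big_nil subvf; left.
rewrite big_cons subv_cap; apply: (iffP andP) => [[UH /IHs Us] G|Us].
  by rewrite inE => /orP[/eqP->//|/Us].
split; first by apply: Us; rewrite mem_head.
by apply/IHs => G Gs; apply: Us; rewrite inE Gs orbT.
Qed.

Lemma bigcap_seq_subv H (s : seq {vspace V}) :
  H \in s -> (\bigcap_(G <- s) G <= H)%VS.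
Proof. exact: (subv_bigcap_seqP _ s (subvv _)). Qed.

Lemma intersection_latticeP W A X :
  reflect (exists2 B, B `<=` A & X = (W :&: \bigcap_(H <- B) H)%VS)
          (X \in intersection_lattice W A).
Proof.
apply: (iffP (imfsetP _ _ _ _)) => -[B BA ->]; exists B => //.
  by rewrite fpowersetE in BA.
by rewrite /= fpowersetE.
Qed.

Lemma lattice_ambient W A : W \in intersection_lattice W A.
Proof.
by apply/intersection_latticeP; exists fset0; rewrite ?fsub0set // big_nil capvf.
Qed.

Lemma lattice_subv W A X : X \in intersection_lattice W A -> (X <= W)%VS.
Proof. by case/intersection_latticeP=> B _ ->; apply: capvSl. Qed.

Lemma lattice_cap W A X H : X \in intersection_lattice W A -> H \in A ->
  (X :&: H)%VS \in intersection_lattice W A.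
Proof.
case/intersection_latticeP=> B BA -> HA; apply/intersection_latticeP.
exists (H |` B); first by rewrite fsubUset fsub1set HA.
apply/eqP; rewrite eqEsubv !subv_cap -!andbA; apply/and5P; split.
- exact: subv_trans (capvSl _ _) (capvSl _ _).
- apply/subv_bigcap_seqP => G /fset1UP[->|GB]; first exact: capvSr.
  apply: subv_trans (capvSl _ _) _; apply: subv_trans (capvSr _ _) _.
  exact: bigcap_seq_subv.
- exact: capvSl.
- apply: subv_trans (capvSr _ _) _; apply/subv_bigcap_seqP => G GB.
  by apply: bigcap_seq_subv; rewrite in_fset1U GB orbT.
- apply: subv_trans (capvSr _ _) _.
  by apply: bigcap_seq_subv; rewrite fset1U1.
Qed.

Lemma lattice_hyperplane W A H : central_arrangement W A -> H \in A ->
  H \in intersection_lattice W A.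
Proof.
move=> cA HA; have /andP[/capv_idPr <- _] := cA _ HA.
exact: lattice_cap (lattice_ambient W A) HA.
Qed.

(** An element of the lattice is cut out by members of [A], so a subspace [U] it
    does not contain must escape one of them. With [U] the ambient space this
    gives a hyperplane containing [X]; with [U] a hyperplane it gives a second
    hyperplane that meets [U] in [X] when [X] has codimension 1 in [U]. *)
Lemma lattice_not_sub W A X U : X \in intersection_lattice W A -> (U <= W)%VS ->
  ~~ (U <= X)%VS -> exists2 H, H \in A & (X <= H)%VS && ~~ (U <= H)%VS.
Proof.
case/intersection_latticeP=> B BA -> UW; rewrite subv_cap UW /= => nUB.
have /hasP[H HB nUH] : has (fun H => ~~ (U <= H)%VS) B.
  apply: contraR nUB => /hasPn UB; apply/subv_bigcap_seqP => H /UB.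
  by rewrite negbK.
exists H; first exact: (fsubsetP BA).
rewrite nUH andbT; apply: subv_trans (capvSr _ _) _.
exact: bigcap_seq_subv.
Qed.

Lemma lattice_proper W A X : X \in intersection_lattice W A -> X != W ->
  exists2 H, H \in A & (X <= H)%VS.
Proof.
move=> XL nXW; have [|H HA /andP[XH _]] := lattice_not_sub XL (subvv W).
  by apply: contra nXW => WX; rewrite eqEsubv (lattice_subv XL).
by exists H.
Qed.

Lemma lattice_codim1 W A X : central_arrangement W A ->
  X \in intersection_lattice W A -> (\dim W <= (\dim X).+1)%N ->
  (X == W) || (X \in A).
Proof.
move=> cA XL leWX; have [//|/= nXW] := eqVneq X W.
have [H HA XH] := lattice_proper XL nXW; have /andP[_ /eqP dW] := cA _ HA.
suff /eqP-> : X == H by [].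
by rewrite eqEdim XH -ltnS -dW.
Qed.

Lemma hyperplane_neq W A H : central_arrangement W A -> H \in A -> H != W.
Proof.
move=> cA HA; have /andP[_] := cA _ HA.
by apply: contraTneq => ->; rewrite eqn_leq ltnn andbF.
Qed.

Lemma zero_in_lattice W A : essential W A -> 0%VS \in intersection_lattice W A.
Proof. by move=> eA; apply/intersection_latticeP; exists A. Qed.

End Lattice.

(** * Möbius function and the value of the characteristic polynomial at -1 *)

Section Moebius.

Variables (K : fieldType) (V : vectType K).
Variables (W : {vspace V}) (A : {fset {vspace V}}).
Implicit Types (X H : {vspace V}).

Local Notation L := (intersection_lattice W A).
Local Notation mu := (mobius (@reverse_inclusion K V) L W).

(** The recursion of [mobius] freed of the constraint that [Y] lie below [W] in
    the order, which every element of the lattice satisfies. *)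
Lemma mu_rec X : X \in L ->
  mu X = if W == X then 1 else - \sum_(Y <- L | (X <= Y)%VS && (Y != X)) mu Y.
Proof.
move=> XL; rewrite mobiusE //; first last.
- by move=> Y X' Z XY YZ; apply: subv_trans YZ XY.
- by move=> X' Y; rewrite /reverse_inclusion andbC => /subv_anti.
- by move=> X'; apply: subvv.
case: eqP => // _; congr (- _); rewrite big_seq_cond [RHS]big_seq_cond.
apply: eq_bigl => Y; case: (boolP (Y \in L)) => //= YL.
by rewrite /reverse_inclusion (lattice_subv YL).
Qed.

Lemma mu_ambient : mu W = 1.
Proof. by rewrite mu_rec ?lattice_ambient ?eqxx. Qed.

Hypothesis cA : central_arrangement W A.

Lemma mu_hyperplane H : H \in A -> mu H = -1.
Proof.
move=> HA; rewrite mu_rec ?(lattice_hyperplane cA) // eq_sym.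
rewrite (negPf (hyperplane_neq cA HA)) big_fset_condE.
suff -> : [fset Y in L | (H <= Y)%VS && (Y != H)] = [fset W].
  by rewrite big_seq_fset1 mu_ambient.
have /andP[HW /eqP dW] := cA HA.
apply/fsetP => Y; rewrite !inE /=; apply/and3P/eqP => [[YL HY nYH]|->].
  apply/eqP; rewrite eqEdim (lattice_subv YL) dW ltnNge.
  by apply: contra nYH => dY; rewrite eq_sym eqEdim HY.
by rewrite lattice_ambient eq_sym (hyperplane_neq cA HA).
Qed.

(** The elements of the lattice strictly containing [X] are [W], with value 1, and
    the hyperplanes through [X], with value -1 each. *)
Lemma mu_codim2 X : X \in L -> \dim W = (\dim X).+2 ->
  mu X = #|` [fset H in A | (X <= H)%VS]|%:Z - 1.
Proof.
move=> XL dW; have ltXW : (\dim X < \dim W)%N by rewrite dW ltnW.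
rewrite mu_rec //; case: eqVneq => [WX|nWX]; first by rewrite WX ltnn in ltXW.
rewrite big_fset_condE.
have -> : [fset Y in L | (X <= Y)%VS && (Y != X)]
          = W |` [fset H in A | (X <= H)%VS].
  apply/fsetP => Y; rewrite !inE /=; apply/and3P/orP => [[YL XY nYX]|].
    have ltXY : (\dim X < \dim Y)%N.
      by rewrite ltnNge; apply: contra nYX => dYX; rewrite eq_sym eqEdim XY.
    have := lattice_codim1 cA YL; rewrite dW ltnS => /(_ ltXY)/orP[->|YA].
      by left.
    by right; rewrite YA.
  case=> [/eqP->|/andP[YA XY]].
    by rewrite lattice_ambient (lattice_subv XL) nWX.
  split=> //; first exact: (lattice_hyperplane cA).
  apply: contra_eq_neq dW => <-; have /andP[_ /eqP->] := cA YA.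
  by rewrite eqSS ltn_eqF.
rewrite big_fsetU1 /= ?mu_ambient; last first.
  by rewrite !inE; apply/negP => /andP[/(hyperplane_neq cA)]; rewrite eqxx.
rewrite (eq_big_seq (fun=> -1)) => [|H]; last first.
  by rewrite !inE => /andP[HA _]; apply: mu_hyperplane.
by rewrite sumrN opprD opprK addrC card_fset_sumZ.
Qed.

Hypotheses (eA : essential W A) (W_gt0 : (0 < \dim W)%N).

(** Essentiality puts 0 in the lattice, and every element contains 0, so the
    recursion for [mu 0] runs over all the other elements. *)
Lemma sum_mu : \sum_(X <- L) mu X = 0.
Proof.
have oL := zero_in_lattice eA.
rewrite (big_fsetD1 _ oL) /= mu_rec //.
have /negPf-> : W != 0%VS by rewrite -dimv_eq0 -lt0n.
rewrite [X in - X + _](_ : _ = \sum_(X <- L `\ 0%VS) mu X) ?addNr //.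
rewrite big_fset_condE; apply: eq_fbigl => X.
by rewrite !inE /= sub0v andbC.
Qed.

(** The sum of [mu X * ((-1) ^ dim X - 1)] is [chi (-1)], because the sum of
    [mu X] vanishes. *)
Lemma char_poly_m1 : (characteristic_poly W A).[-1]
  = - 2 * \sum_(X <- L | odd (\dim X)) mu X.
Proof.
rewrite -[LHS]subr0 -[X in _ - X]sum_mu /characteristic_poly horner_sum -sumrB.
rewrite [in RHS]big_mkcond mulr_sumr; apply: eq_bigr => X _.
rewrite hornerCM hornerXn -signr_odd; case: odd => /=; ring.
Qed.

End Moebius.

(** * Arrangements in dimensions 2 and 3 *)

(** In a plane the odd-dimensional elements are lines, that is the members of
    [A], each with [mu] equal to -1. *)
Lemma char_poly_m1_plane (K : fieldType) (V : vectType K) (W : {vspace V})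
    (A : {fset {vspace V}}) :
  central_arrangement W A -> essential W A -> \dim W = 2%N ->
  (characteristic_poly W A).[-1] = 2 * #|` A|%:Z.
Proof.
move=> cA eA dW; rewrite char_poly_m1 ?dW // big_fset_condE.
rewrite (_ : [fset X in _ | _] = A); last first.
  apply/fsetP => X; rewrite !inE /=; apply/andP/idP => [[XL oX]|XA].
    have := lattice_codim1 cA XL; rewrite dW.
    case: eqVneq oX => [->|_ oX /=]; first by rewrite dW.
    by apply; case: (\dim X) oX.
  have /andP[_] := cA _ XA; rewrite dW eqSS => /eqP<-.
  by rewrite (lattice_hyperplane cA).
rewrite (eq_big_seq (fun=> -1)) => [|H HA]; last exact: mu_hyperplane.
by rewrite sumrN mulrNN card_fset_sumZ.
Qed.

Section Space.

Variables (K : fieldType) (V : vectType K).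
Variables (W : {vspace V}) (A : {fset {vspace V}}).
Hypotheses (cA : central_arrangement W A) (eA : essential W A).
Hypothesis dW : \dim W = 3%N.

Let P := [fset v in intersection_lattice W A | \dim v == 1%N].

(** The odd dimensions up to 3 are 1 and 3: they select [P] and [W]. *)
Lemma char_poly_m1_space : (characteristic_poly W A).[-1]
  = - 2 * (1 + \sum_(v <- P) (#|` [fset H in A | (v <= H)%VS]|%:Z - 1)).
Proof.
rewrite char_poly_m1 ?dW // big_fset_condE.
rewrite (_ : [fset X in _ | _] = W |` P); last first.
  apply/fsetP => X; rewrite !inE /=.
  case: eqVneq => [->|nXW] /=; first by rewrite lattice_ambient dW.
  case: (boolP (X \in _)) => //= XL.
  have ltX3 : (\dim X < 3)%N.
    by rewrite ltnNge -dW; apply: contra nXW; rewrite eqEdim (lattice_subv XL).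
  by case: (\dim X) ltX3 => [|[|[|]]].
rewrite big_fsetU1 /= ?mu_ambient; last by rewrite !inE dW andbF.
congr (_ * (_ + _)); apply: eq_big_seq => v.
by rewrite !inE => /andP[vL /eqP dv]; rewrite mu_codim2 ?dv.
Qed.

(** A line [v] of [P] inside [H] is cut out by some other [G] in [A] that does not
    contain [H]; then [v] and [H :&: G] are both lines, hence equal. *)
Lemma restriction_lines H : H \in A ->
  restriction A H = [fset v in P | (v <= H)%VS].
Proof.
move=> HA; have /andP[HW dH] := cA HA.
have dim_cap v : v \in restriction A H -> \dim v = 1%N.
  case/(restriction_central cA HW)/andP=> _; move: dH.
  by rewrite dW eqSS => /eqP<- /eqP[].
have in_restr G : G \in A -> ~~ (H <= G)%VS -> (H :&: G)%VS \in restriction A H.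
  by move=> GA nHG; apply/imfsetP; exists G; rewrite //= inE GA.
apply/fsetP => v; rewrite !inE /=; apply/idP/andP => [vR|[/andP[vL /eqP dv] vH]].
  rewrite (dim_cap v vR) eqxx andbT; case/imfsetP: vR => G /=.
  rewrite inE => /andP[GA _] ->.
  by rewrite capvSl lattice_cap ?(lattice_hyperplane cA).
have [|G GA /andP[vG nHG]] := lattice_not_sub vL HW.
  apply: contraTN dH => /dimvS; rewrite dv dW eqSS.
  by case: (\dim H) => [|[|]].
have HG_R := in_restr G GA nHG.
suff /eqP-> : v == (H :&: G)%VS by [].
by rewrite eqEdim subv_cap vH vG (dim_cap _ HG_R) dv.
Qed.

(** Intersecting all the [H :&: G] gives the intersection of all of [A], since the
    members [G] that contain [H] cut nothing off. *)
Lemma restriction_essential H : H \in A -> essential H (restriction A H).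
Proof.
move=> HA; apply/eqP; rewrite -subv0 -eA; have /andP[HW _] := cA HA.
rewrite subv_cap; apply/andP; split; first exact: subv_trans (capvSl _ _) HW.
apply/subv_bigcap_seqP => G GA.
have [HG|nHG] := boolP (H <= G)%VS; first exact: subv_trans (capvSl _ _) HG.
apply: subv_trans (capvSr _ _) _; apply: subv_trans (capvSr H G).
by apply: bigcap_seq_subv; apply/imfsetP; exists G; rewrite //= inE GA.
Qed.

(** Each restriction lives in a plane, so its term is twice the number of lines of
    [P] inside [H]; the sum is then a double count of incident pairs. *)
Lemma sum_char_poly_restriction :
  \sum_(H <- A) (characteristic_poly H (restriction A H)).[-1]
  = 2 * \sum_(v <- P) #|` [fset H in A | (v <= H)%VS]|%:Z.
Proof.
rewrite mulr_sumr; under [RHS]eq_bigr do rewrite card_fset_condZ mulr_sumr.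
rewrite exchange_big; apply: eq_big_seq => H HA /=.
have /andP[HW dH] := cA HA.
rewrite char_poly_m1_plane.
- by rewrite restriction_lines // card_fset_condZ mulr_sumr.
- exact: restriction_central cA HW.
- exact: restriction_essential.
- by move: dH; rewrite dW eqSS => /eqP.
Qed.

End Space.

Theorem corollary2p6 (K : fieldType) (A : {fset {vspace 'rV[K]_3}})
    (A_central : central_arrangement fullv A) (A_essential : essential fullv A) :
  let P := [fset v in intersection_lattice fullv A | \dim v == 1%N] in
  combinatorially_simplicial A <->
  3 * (#|` P|%:Z - 1)
    = \sum_(v <- P) #|` [fset H in A | (v <= H)%VS]|%:Z.
Proof.
move=> P; have d3 : \dim {:'rV[K]_3} = 3%N by rewrite dimvf /dim /= mul1n.
rewrite /combinatorially_simplicial.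
rewrite (char_poly_m1_space A_central A_essential d3).
rewrite (sum_char_poly_restriction A_central A_essential d3) -/P.
rewrite sumrB -card_fset_sumZ.
set S := \sum_(v <- P) _; split=> [[_ _ eqS]|eqS]; last split=> //; lra.
Qed.
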